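(* Let $q$ be an asymmetric lattice norm on $\mathbb R^{2}$. Every $q$-compact convex set $K\subset\mathbb R^{2}$ is strongly $q$-compact; that is, there exists a $q^{s}$-compact set $K_0$ such that $K_0\subseteq K\subseteq K_0+\theta_0$.
   Context: A lattice norm on $\mathbb R^2$ (with the coordinatewise order) is a norm $\|\cdot\|$ such that $\|x\|\le\|y\|$ whenever $|x|\le|y|$ coordinatewise. An asymmetric lattice norm is a function of the form $q(x)=\|x\vee 0\|$, where $\|\cdot\|$ is a lattice norm and $x\vee 0$ is the coordinatewise maximum of $x$ and $0$. The $q$-topology on $\mathbb R^2$ is the (non-Hausdorff) topology generated by the balls $B^q_\varepsilon(x)=\{y: q(y-x)<\varepsilon\}$, $\varepsilon>0$. The function $q^s(x)=\max\{q(x),q(-x)\}$ is a norm on $\mathbb R^2$, and the $q^s$-topology is its norm topology. A set is $q$-compact (resp. $q^s$-compact) if it is compact in the $q$-topology (resp. the $q^s$-topology); compactness means that every open cover has a finite subcover (no separation axiom is required). Put $\theta_0=\{x\in\mathbb R^2: q(x)=0\}=(-\infty,0]\times(-\infty,0]$. *)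

(* Defs.v *)
(* The real line is rendered by an arbitrary R : realType. *)
From HB Require Import structures.
From mathcomp Require Export all_boot all_order all_algebra.
From mathcomp Require Export all_classical all_reals all_analysis.

Set Implicit Arguments.
Unset Strict Implicit.
Unset Printing Implicit Defensive.

Import Order.TTheory GRing.Theory Num.Theory.

Local Open Scope classical_set_scope.
Local Open Scope ring_scope.

(* Nonnegativity and N 0 = 0 follow from these three axioms. *)
Record is_norm (R : realType) (N : 'rV[R]_2 -> R) : Prop := IsNorm {
  is_norm_triangle : forall x y, N (x + y) <= N x + N y ;
  is_norm_scale : forall (a : R) x, N (a *: x) = `|a| * N x ;
  is_norm_eq0 : forall x, N x = 0 -> x = 0 }.

Definition is_lattice_norm (R : realType) (N : 'rV[R]_2 -> R) : Prop :=
  is_norm N /\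
  forall x y : 'rV[R]_2, (forall i, `|x 0 i| <= `|y 0 i|) -> N x <= N y.

Definition pos_part (R : realType) (x : 'rV[R]_2) : 'rV[R]_2 :=
  \row_i Num.max (x 0 i) 0.

Definition is_asym_lattice_norm (R : realType) (q : 'rV[R]_2 -> R) : Prop :=
  exists2 N : 'rV[R]_2 -> R,
    is_lattice_norm N & forall x, q x = N (pos_part x).

Definition qball (R : realType) (q : 'rV[R]_2 -> R)
    (x : 'rV[R]_2) (e : R) : set 'rV[R]_2 :=
  [set y | q (y - x) < e].

Definition qballs (R : realType) (q : 'rV[R]_2 -> R) : set (set 'rV[R]_2) :=
  [set B | exists x e, 0 < e /\ B = qball q x e].

(* A copy of R^2, so that it can carry the topology generated by the q-balls
   instead of the product topology that the library puts on 'rV[R]_2. *)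
Definition qspace (R : realType) (q : 'rV[R]_2 -> R) : Type := 'rV[R]_2.

HB.instance Definition _ (R : realType) (q : 'rV[R]_2 -> R) :=
  Choice.copy (qspace q) 'rV[R]_2.

HB.instance Definition _ (R : realType) (q : 'rV[R]_2 -> R) :=
  isPointed.Build (qspace q) (0 : 'rV[R]_2).

HB.instance Definition _ (R : realType) (q : 'rV[R]_2 -> R) :=
  isSubBaseTopological.Build (qspace q) (qballs q) id.

Definition q_compact (R : realType) (q : 'rV[R]_2 -> R)
    (K : set 'rV[R]_2) : Prop :=
  cover_compact (K : set (qspace q)).

Definition qs (R : realType) (q : 'rV[R]_2 -> R) (x : 'rV[R]_2) : R :=
  Num.max (q x) (q (- x)).

Definition theta0 (R : realType) (q : 'rV[R]_2 -> R) : set 'rV[R]_2 :=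
  [set x | q x = 0].

(* As qs q is a norm, its norm topology is the one generated by its balls, so
   qs-compactness is q_compact at qs q. *)
Definition strongly_q_compact (R : realType) (q : 'rV[R]_2 -> R)
    (K : set 'rV[R]_2) : Prop :=
  exists K0 : set 'rV[R]_2,
    [/\ q_compact (qs q) K0, K0 `<=` K
      & K `<=` [set x + t | x in K0 & t in theta0 q]].

(* Main.v *)
(* Let p maximise the second coordinate over K and r the first one; both exist
   by q-compactness. Every point of K lies below a point of K that is either on
   or above the segment [p, r], inside the box with corners p and r. Take for K0
   the points of this part of the box lying below some point w of K. The set of
   all points below some point of K is closed (q-compactness again), hence K0 is
   compact; and each point of K0 lies in a triangle p, r, w, hence in K. *)
Require Import Defs.
From mathcomp Require Import ring lra.

Set Implicit Arguments.
Unset Strict Implicit.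
Unset Printing Implicit Defensive.

Import Order.TTheory GRing.Theory Num.Theory.
Import numFieldNormedType.Exports.

Local Open Scope classical_set_scope.
Local Open Scope ring_scope.

(** * Coordinates of row vectors *)

Lemma ord2_ind (P : 'I_2 -> Prop) : P 0 -> P 1 -> forall i, P i.
Proof.
move=> P0 P1 [[|[|//]] lti].
- by rewrite (_ : Ordinal lti = 0) //; exact/val_inj.
- by rewrite (_ : Ordinal lti = 1) //; exact/val_inj.
Qed.

Lemma normr_coord_le (R : realType) (m n : nat) (x : 'M[R]_(m, n)) i j :
  `|x i j| <= `|x|.
Proof.
rewrite [leRHS]mx_normrE.
exact: (le_bigmax _ (fun k : 'I_m * 'I_n => `|x k.1 k.2|) (i, j)).
Qed.

Lemma continuous_affine_coord (R : realType) (n : nat) (i : 'I_n) (c d : R) :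
  continuous (fun z : 'rV[R]_n => (z 0 i - c) * d).
Proof.
move=> z; have F : Filter (nbhs z) by exact: nbhs_filter.
have zi : y 0 i @[y --> z] --> z 0 i by exact: coord_continuous.
apply: (@cvgM R _ _ F (fun y : 'rV[R]_n => y 0 i - c) (fun=> d));
  last exact: cvg_cst.
apply: (@cvgB R R^o _ _ F (fun y : 'rV[R]_n => y 0 i) (fun=> c));
  first exact: zi.
exact: cvg_cst.
Qed.

(** * Comparison of a lattice norm with coordinates and the sup norm *)

Section LatticeNorm.
Context (R : realType) (N : 'rV[R]_2 -> R).
Hypothesis hN : is_lattice_norm N.
Implicit Types x y : 'rV[R]_2.

Lemma lattice_norm_ge0 x : 0 <= N x.
Proof.
case: hN => hN1 _.
have := is_norm_triangle hN1 x (- x).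
rewrite -(scaleN1r x) (is_norm_scale hN1) normrN1 mul1r scaleN1r subrr.
have := is_norm_scale hN1 0 x; rewrite scale0r normr0 mul0r => ->.
by lra.
Qed.

(** The vector [x 0 i *: delta_mx 0 i] is dominated coordinatewise by [x]. *)
Lemma lattice_norm_coord x i : `|x 0 i| * N (delta_mx 0 i) <= N x.
Proof.
case: hN => hN1 hNle.
rewrite -(is_norm_scale hN1); apply: hNle => j; rewrite !mxE eqxx /=.
have [->|_] := eqVneq j i; first by rewrite mulr1.
by rewrite mulr0 normr0 normr_ge0.
Qed.

Lemma lattice_norm_delta_gt0 i : 0 < N (delta_mx 0 i).
Proof.
rewrite lt_neqAle lattice_norm_ge0 andbT eq_sym; apply/eqP.
case: hN => hN1 _ /(is_norm_eq0 hN1) /rowP /(_ i) /eqP.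
by rewrite !mxE !eqxx oner_eq0.
Qed.

Lemma lattice_norm_le_mx_norm x : N x <= `|x| * N (const_mx 1).
Proof.
case: hN => hN1 hNle.
rewrite -[X in X * _]normr_id -(is_norm_scale hN1).
by apply: hNle => i; rewrite !mxE mulr1 normr_id normr_coord_le.
Qed.

End LatticeNorm.

(** * The q-topology and the topology of [qs q] *)

Section AsymLatticeNorm.
Context (R : realType) (q : 'rV[R]_2 -> R).
Hypothesis hq : is_asym_lattice_norm q.
Implicit Types x y z : 'rV[R]_2.

(** A small [q x] controls the coordinates from above only; this makes the half planes [x 0 i < c]
    q-open. *)
Lemma asym_norm_coord_lt i (e : R) : 0 < e ->
  exists2 d, 0 < d & forall x, q x < d -> x 0 i < e.
Proof.
case: hq => N hN qE e0; have Ni := lattice_norm_delta_gt0 hN i.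
exists (e * N (delta_mx 0 i)); first exact: mulr_gt0.
move=> x; rewrite qE => /(le_lt_trans (lattice_norm_coord hN _ i)).
rewrite ltr_pM2r // mxE ger0_norm; last by rewrite le_max lexx orbT.
by apply: le_lt_trans; rewrite le_max lexx.
Qed.

Lemma asym_norm_eq0 x : (forall i, x 0 i <= 0) -> q x = 0.
Proof.
case: hq => N hN qE x0; rewrite qE.
suff -> : pos_part x = 0.
  by case: hN => hN1 _; rewrite -(scale0r 0) (is_norm_scale hN1) normr0 mul0r.
by apply/rowP => i; rewrite !mxE; apply/max_idPr.
Qed.

(** The positive part is subadditive coordinatewise, and the lattice norm is monotone on nonnegative
    vectors. *)
Lemma asym_norm_triangle x y : q (x + y) <= q x + q y.
Proof.
case: hq => N [hN1 hNle] qE; rewrite !qE.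
apply: le_trans (is_norm_triangle hN1 _ _); apply: hNle => i; rewrite !mxE.
rewrite !ger0_norm ?addr_ge0 ?le_max ?lexx ?orbT //.
rewrite ge_max lerD ?le_max ?lexx //=.
by rewrite addr_ge0 ?le_max ?lexx ?orbT.
Qed.

Lemma asym_norm_le_mx_norm :
  exists2 C : R, 0 <= C & forall x, q x <= `|x| * C.
Proof.
case: hq => N hN qE; exists (N (const_mx 1)); first exact: lattice_norm_ge0.
move=> x; rewrite qE; apply: le_trans (lattice_norm_le_mx_norm hN x).
case: hN => _; apply => i; rewrite mxE.
rewrite ger0_norm ?le_max ?lexx ?orbT // ge_max normr_ge0 andbT.
exact: ler_norm.
Qed.

Lemma qball_open x (e : R) : 0 < e -> open (qball q x e : set (qspace q)).
Proof.
move=> e0; exists [set qball q x e].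
  by move=> _ ->; apply: finI_from1; exists x, e.
by rewrite bigcup_set1.
Qed.

Lemma open_coord_lt i (c : R) :
  open ([set x | x 0 i < c] : set (qspace q)).
Proof.
rewrite openE => x /= xc; have [|d d0 dP] := @asym_norm_coord_lt i (c - x 0 i).
  by rewrite subr_gt0.
rewrite /interior nbhsE; exists (qball q x d).
  split; first exact: qball_open.
  by rewrite /qball /= subrr asym_norm_eq0 // => j; rewrite mxE.
by move=> y /dP; rewrite !mxE ltrD2r.
Qed.

Lemma open_qsball x (e : R) : open (qball (qs q) x e).
Proof.
have [C C0 qC] := asym_norm_le_mx_norm.
rewrite openE => y; rewrite /qball /= /qs gt_max => /andP[y1 y2].
pose d := Num.min (e - q (y - x)) (e - q (- (y - x))).
have d0 : 0 < d by rewrite lt_min !subr_gt0 y1.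
(* [C] may vanish, hence the denominator [C + 1]. *)
apply/nbhs_ballP; exists (d / (C + 1)).
  by rewrite /= divr_gt0 // ltr_wpDl.
move=> z; rewrite mx_norm_ball /ball_ /= => yz.
have small : `|y - z| * C < d.
  apply: (@le_lt_trans _ _ (`|y - z| * (C + 1))).
    by rewrite ler_wpM2l // lerDl.
  by rewrite -ltr_pdivlMr // ltr_wpDl.
move: small; rewrite lt_min => /andP[s1 s2]; rewrite gt_max; apply/andP; split.
- have -> : z - x = (z - y) + (y - x) by apply/rowP => i; rewrite !mxE; ring.
  apply: le_lt_trans (asym_norm_triangle _ _) _.
  by have := qC (z - y); rewrite distrC; lra.
- have -> : - (z - x) = (y - z) + (- (y - x)).
    by apply/rowP => i; rewrite !mxE; ring.
  apply: le_lt_trans (asym_norm_triangle _ _) _.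
  by have := qC (y - z); lra.
Qed.

(** The balls of [qs q] are open for the product topology, so every open cover for [qs q] is an open
    cover for the product topology. *)
Lemma qs_compact (K : set 'rV[R]_2) : compact K -> q_compact (qs q) K.
Proof.
rewrite compact_cover => cK I D f fo; apply: cK => i /fo [D' D'sub <-].
apply: bigcup_open => A /D'sub [F Fsub <-].
rewrite bigcap_fset big_seq; apply: big_ind.
- exact: openT.
- exact: (@openI 'rV[R]_2).
- move=> B BF; have [x [e [_ ->]]] : qballs (qs q) B := set_mem (Fsub _ BF).
  exact: open_qsball.
Qed.

End AsymLatticeNorm.

(** * Consequences of q-compactness *)

Lemma cover_compact_chain (T : topologicalType) (R : realType) (K : set T)
    (D : set R) (f : R -> set T) :
  cover_compact K -> D !=set0 -> (forall c, D c -> open (f c)) ->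
  {homo f : c d / c <= d >-> c `<=` d} -> K `<=` cover D f ->
  exists2 c, D c & K `<=` f c.
Proof.
move=> cK [c0 Dc0] fo fle /(cK _ D f fo) [D' D'sub Ksub].
(* The largest index of a finite subcover works alone; [c0] serves when that subcover is empty. *)
suff [c Dc cmax] : exists2 c, D c &
    forall d, d \in finmap.enum_fset D' -> d <= c.
  exists c => // x /Ksub [d /= dD' fdx]; exact: fle (cmax _ dD') _ fdx.
have : forall d, d \in finmap.enum_fset D' -> D d.
  by move=> d /D'sub; rewrite inE.
elim: (finmap.enum_fset D') => [|a s IHs] sub; first by exists c0.
have [|c Dc cmax] := IHs; first by move=> d ds; apply: sub; rewrite inE ds orbT.
exists (Num.max a c); first by case: leP => // _; apply: sub; rewrite inE eqxx.
move=> d; rewrite inE le_max => /predU1P[->|/cmax ->]; last by rewrite orbT.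
by rewrite lexx.
Qed.

Section QCompact.
Context (R : realType) (q : 'rV[R]_2 -> R).
Hypothesis hq : is_asym_lattice_norm q.
Variable K : set 'rV[R]_2.
Hypothesis cK : q_compact q K.
Implicit Types x y z : 'rV[R]_2.

Lemma q_compact_coord_max i : K !=set0 ->
  exists2 p, K p & forall x, K x -> x 0 i <= p 0 i.
Proof.
move=> [x0 Kx0]; apply: contrapT => nomax.
(* Without a maximum, the half planes bounded by attained values [c] cover [K]; a single one would
   contain [K], including a point where [c] is attained. *)
have [||||_ [x Kx <-] Kc] := @cover_compact_chain (qspace q) R K
    [set x 0 i | x in K] (fun c => [set x | x 0 i < c]) cK.
- by exists (x0 0 i), x0.
- by move=> c _; exact: open_coord_lt.
- by move=> c d cd x /= /lt_le_trans; apply.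
- move=> x Kx; apply: contrapT => nx; apply: nomax; exists x => // y Ky.
  by rewrite leNgt; apply/negP => xy; apply: nx; exists (y 0 i) => //; exists y.
- by have := Kc _ Kx; rewrite /= ltxx.
Qed.

(** This is the sum of [A] and the negative quadrant [theta0 q]. *)
Definition downset (A : set 'rV[R]_2) : set 'rV[R]_2 :=
  [set z | exists2 w, A w & forall i, z 0 i <= w 0 i].

Lemma closed_q_compact_downset : closed (downset K).
Proof.
rewrite -openC openE => z zK.
(* Each point of [K] has some coordinate strictly below that of [z]. Compactness makes the gap
   uniform: [- c] works for all of [K], and the ball of that radius around [z] misses the
   downset. *)
have [||||c c0 Kc] := @cover_compact_chain (qspace q) R K
    [set c | c < 0] (fun c => \bigcup_i [set x | x 0 i < z 0 i + c]) cK.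
- by exists (-1); rewrite /= oppr_lt0.
- by move=> c _; apply: bigcup_open => i _; exact: open_coord_lt.
- move=> c d cd x [i _ /= xi]; exists i => //=.
  by apply: lt_le_trans xi _; rewrite lerD2l.
- move=> w Kw; apply: contrapT => nw; apply: zK; exists w => // i.
  rewrite leNgt; apply/negP => wz; apply: nw.
  exists ((w 0 i - z 0 i) / 2); first by rewrite /=; lra.
  by exists i => //=; lra.
- apply/nbhs_ballP; exists (- c); first by rewrite /= oppr_gt0.
  move=> y; rewrite mx_norm_ball /ball_ /= => zy [w /Kc [i _ /= wz] yw].
  have := le_lt_trans (normr_coord_le (z - y) 0 i) zy.
  move=> /(le_lt_trans (ler_norm _)); rewrite !mxE.
  by have := yw i; lra.
Qed.

End QCompact.

(** * Convexity in the plane *)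

Lemma convex_comb_itv (R : realType) (a b c : R) : a <= c -> c <= b ->
  exists t, [/\ 0 <= t, t <= 1 & c = t * a + (1 - t) * b].
Proof.
move=> ac cb; have [ab|ab] := eqVneq a b.
  by exists 0; split => //; lra.
have ab' : 0 < b - a by rewrite subr_gt0 lt_neqAle ab; lra.
exists ((b - c) / (b - a)); split.
- by rewrite divr_ge0 //; lra.
- by rewrite ler_pdivrMr //; lra.
- by field; rewrite gt_eqF.
Qed.

Section ConvexPlane.
Context (R : realType) (K : set 'rV[R]_2).
Hypothesis Kconvex : convex_set K.
Implicit Types x y z : 'rV[R]_2.

Lemma convex_set_comb x y (t : R) : K x -> K y -> 0 <= t -> t <= 1 ->
  K (t *: x + (1 - t) *: y).
Proof.
move=> Kx Ky t0 t1.
by have := @Kconvex x y (Itv01 t0 t1); rewrite !inE; apply.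
Qed.

Lemma convex_set_vertical x y z : K x -> K y ->
  x 0 0 = z 0 0 -> y 0 0 = z 0 0 -> x 0 1 <= z 0 1 -> z 0 1 <= y 0 1 -> K z.
Proof.
move=> Kx Ky xz yz xz1 zy1.
have [t [t0 t1 zE]] := convex_comb_itv xz1 zy1.
suff -> : z = t *: x + (1 - t) *: y by exact: convex_set_comb.
by apply/rowP; apply: ord2_ind; rewrite !mxE // xz yz; ring.
Qed.

(* The point z lies in the triangle p, r, w: the vertical line through z meets
   the segment [p, r] below z and the segment [p, w] above z. *)
Lemma convex_set_triangle p r w z : K p -> K r -> K w ->
  p 0 0 <= z 0 0 -> z 0 0 <= r 0 0 -> r 0 1 <= z 0 1 -> w 0 1 <= p 0 1 ->
  (forall i, z 0 i <= w 0 i) ->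
  (r 0 0 - p 0 0) * (p 0 1 - r 0 1) <=
    (z 0 0 - p 0 0) * (p 0 1 - r 0 1) + (z 0 1 - r 0 1) * (r 0 0 - p 0 0) ->
  K z.
Proof.
move=> Kp Kr Kw pz zr rz wp zw above.
have [t [t0 t1 tE]] := convex_comb_itv pz (zw 0).
have [s [s0 s1 sE s_le]] : exists s, [/\ 0 <= s, s <= 1,
    z 0 0 = s * p 0 0 + (1 - s) * r 0 0 &
    s * p 0 1 + (1 - s) * r 0 1 <= z 0 1].
  have [pr|pr] := eqVneq (p 0 0) (r 0 0).
    (* If [p] and [r] are on one vertical line, [r] itself is the point below [z]. *)
    by exists 0; split => //; lra.
  have [s [s0 s1 sE]] := convex_comb_itv pz zr; exists s; split => //.
  have pr0 : 0 < r 0 0 - p 0 0.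
    by rewrite subr_gt0 lt_neqAle pr; lra.
  have zE : z 0 0 - p 0 0 = (1 - s) * (r 0 0 - p 0 0) by rewrite sE; ring.
  by rewrite -subr_ge0 -(pmulr_lge0 _ pr0); move: above; rewrite zE; lra.
apply: (@convex_set_vertical (s *: p + (1 - s) *: r) (t *: p + (1 - t) *: w)).
- exact: convex_set_comb.
- exact: convex_set_comb.
- by rewrite !mxE.
- by rewrite !mxE.
- by rewrite !mxE.
(* As [w 0 1 <= p 0 1], the segment from [p] to [w] stays at height at least [w 0 1], hence at least
   [z 0 1]. *)
- by rewrite !mxE; have := zw 1; nra.
Qed.

End ConvexPlane.

Theorem theorem6 (R : realType) (q : 'rV[R]_2 -> R)
    (hq : is_asym_lattice_norm q) (K : set 'rV[R]_2)
    (Kconvex : convex_set K) (Kcompact : q_compact q K) :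
  strongly_q_compact q K.
Proof.
have [->|K0] := eqVneq K set0.
  exists set0; split => //; apply: qs_compact => //; exact: compact0.
move/set0P: K0 => K0.
have [p Kp pmax] := q_compact_coord_max hq Kcompact 1 K0.
have [r Kr rmax] := q_compact_coord_max hq Kcompact 0 K0.
(* An affine function, equal to [area p] on the line through p and r. *)
pose area (z : 'rV[R]_2) :=
  (z 0 0 - p 0 0) * (p 0 1 - r 0 1) + (z 0 1 - r 0 1) * (r 0 0 - p 0 0).
(* [corner p r] is the lower left corner of the box and [corner r p] the upper right one. *)
pose corner (u v : 'rV[R]_2) : 'rV[R]_2 :=
  \row_i if i == 0 then u 0 i else v 0 i.
pose side i : set R := `[corner p r 0 i, corner r p 0 i]%classic.
pose box := [set z : 'rV[R]_2 | forall i, side i (z 0 i)].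
have box_compact : compact box.
  by apply: (@rV_compact R 2 side) => i; exact: segment_compact.
pose above := [set z | area z >= area p].
have boxP z : box z -> [/\ p 0 0 <= z 0 0, z 0 0 <= r 0 0,
    r 0 1 <= z 0 1 & z 0 1 <= p 0 1].
  move=> zbox; have := zbox 0; have := zbox 1.
  by rewrite /side /= !mxE /= !in_itv /= => /andP[? ?] /andP[? ?].
have K0K : downset K `&` box `&` above `<=` K.
  move=> z [[[w Kw zw] /boxP[pz zr rz zp]] za].
  apply: (convex_set_triangle Kconvex Kp Kr Kw) => //; first exact: pmax.
  by move: za; rewrite /above /area /=; lra.
exists (downset K `&` box `&` above); split => //.
- apply: qs_compact => //.
  apply: (subclosed_compact _ box_compact); last by move=> z [[]].
  have area_cont : continuous area.
    move=> z; have F : Filter (nbhs z) by exact: nbhs_filter.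
    apply: (@cvgD R R^o _ _ F
      (fun y : 'rV[R]_2 => (y 0 0 - p 0 0) * (p 0 1 - r 0 1))
      (fun y : 'rV[R]_2 => (y 0 1 - r 0 1) * (r 0 0 - p 0 0)));
      exact: continuous_affine_coord.
  apply: closedI; last first.
    apply: (@preimage_closed _ _ area [set t | area p <= t]);
      last exact: closed_ge.
    by move=> z _; exact: area_cont.
  apply: closedI; first exact: (closed_q_compact_downset hq).
  by apply: compact_closed box_compact; exact: norm_hausdorff.
- move=> x Kx.
  suff [k K0k xk] : exists2 k, (downset K `&` box `&` above) k &
      forall i, x 0 i <= k 0 i.
    exists k => //; exists (x - k); last by rewrite addrC subrK.
    by apply: asym_norm_eq0 => // i; rewrite !mxE subr_le0.
  have inK0 z : K z -> r 0 1 <= z 0 1 -> p 0 0 <= z 0 0 -> area p <= area z ->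
      (downset K `&` box `&` above) z.
    move=> Kz rz pz za; split=> //; split; first by exists z.
    by apply: ord2_ind; rewrite /side /= !mxE /= in_itv /=; apply/andP;
      split => //; [exact: rmax|exact: pmax].
  (* Points left of [p] are below [p], points under the height of [r] are below [r], and other
     points on or above the line through [p] and [r] serve themselves. *)
  have [xp|px] := leP (x 0 0) (p 0 0).
    exists p; first by apply: inK0 => //; exact: pmax.
    by apply: ord2_ind => //; exact: pmax.
  have [xr|rx] := leP (x 0 1) (r 0 1).
    exists r; first by apply: inK0 => //; [exact: rmax|rewrite /area; lra].
    by apply: ord2_ind => //; exact: rmax.
  have [xa|ax] := leP (area p) (area x).
    by exists x => //; apply: inK0 => //; exact: ltW.
  (* Here [x] is strictly under the line; the point of the segment vertically above [x] is taken. *)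
  have [s [s0 s1 sE]] := convex_comb_itv (ltW px) (rmax x Kx).
  have pr0 : 0 < r 0 0 - p 0 0 by have := rmax x Kx; lra.
  have rp1 := pmax r Kr.
  exists (s *: p + (1 - s) *: r).
    apply: inK0; first exact: convex_set_comb.
    + by rewrite !mxE; nra.
    + by rewrite !mxE; nra.
    + by rewrite /area !mxE; lra.
  apply: ord2_ind; rewrite !mxE -?sE //.
  have xE : x 0 0 - p 0 0 = (1 - s) * (r 0 0 - p 0 0) by rewrite sE; ring.
  by rewrite -subr_ge0 -(pmulr_lge0 _ pr0); move: ax; rewrite /area xE; lra.
Qed.
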